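(* Let $\mathcal{M}=\{M_1,\dots,M_m\}\subseteq\mathbb{S}^{n+1}$ and $M_{\mathrm{obj}}\in\mathbb{S}^{n+1}$ be such that (1) $\mathcal{S}(\mathcal{M})$ is rank-one generated, (2) there exists $\bar x\in\mathbb{R}^n$ such that $q_i(\bar x)<0$ for all $i\in\{1,\dots,m\}$, and (3) there exist $\bar\gamma\in\mathbb{R}^m_+$ and $\bar\alpha\in\mathbb{R}$ such that $M_{\mathrm{obj}}+\sum_{i=1}^m\bar\gamma_iM_i-\bar\alpha\,e_{n+1}e_{n+1}^\top\in\mathbb{S}^{n+1}_+$. Then, for every $\alpha\in\mathbb{R}$, the implication $$q_i(x)\le0\ \ \forall i\in\{1,\dots,m\}\quad\Longrightarrow\quad q_{\mathrm{obj}}(x)\ge\alpha$$ holds for all $x\in\mathbb{R}^n$ if and only if there exists $\gamma\in\mathbb{R}^m_+$ such that $$q_{\mathrm{obj}}(x)+\sum_{i=1}^m\gamma_iq_i(x)\ge\alpha\quad\text{for all }x\in\mathbb{R}^n.$$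
   Context: $\mathbb{S}^{n+1}$ is the space of real symmetric $(n+1)\times(n+1)$ matrices, $\mathbb{S}^{n+1}_+$ the cone of positive semidefinite ones, $\langle\cdot,\cdot\rangle$ the trace inner product, $e_{n+1}$ the last standard basis vector of $\mathbb{R}^{n+1}$, and $\mathbb{R}^m_+$ the nonnegative orthant. For $x\in\mathbb{R}^n$, $$q_i(x)=\begin{pmatrix}x\\1\end{pmatrix}^\top M_i\begin{pmatrix}x\\1\end{pmatrix},\qquad q_{\mathrm{obj}}(x)=\begin{pmatrix}x\\1\end{pmatrix}^\top M_{\mathrm{obj}}\begin{pmatrix}x\\1\end{pmatrix}.$$ For $\mathcal{M}\subseteq\mathbb{S}^{n+1}$, $$\mathcal{S}(\mathcal{M})=\{Z\in\mathbb{S}^{n+1}:\ Z\succeq0,\ \langle M,Z\rangle\le0\ \ \forall M\in\mathcal{M}\}.$$ A closed convex cone $\mathcal{S}\subseteq\mathbb{S}^{n+1}_+$ is rank-one generated (ROG) if $\mathcal{S}=\mathrm{conv}(\mathcal{S}\cap\{zz^\top:z\in\mathbb{R}^{n+1}\})$. *)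

(* Defs.v *)
From HB Require Import structures.
From mathcomp Require Import all_boot all_order all_algebra.
From mathcomp Require Import mathcomp_extra boolp classical_sets reals.

Set Implicit Arguments.
Unset Strict Implicit.
Unset Printing Implicit Defensive.

Import Order.TTheory GRing.Theory Num.Theory.

Local Open Scope classical_set_scope.
Local Open Scope ring_scope.

Section Defs.
Context {R : realType}.

Definition nonneg_orthant (m : nat) : set 'cV[R]_m :=
  [set v | forall i, 0 <= v i 0].

Definition quad_form (N : nat) (A : 'M[R]_N) (z : 'cV[R]_N) : R :=
  (z^T *m A *m z) 0 0.

Definition psd_cone (N : nat) : set 'M[R]_N :=
  [set A | A \is symmetricmx /\ forall z : 'cV[R]_N, 0 <= quad_form A z].

Definition trace_inner (N : nat) (A B : 'M[R]_N) : R := \tr (A^T *m B).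

Definition convex_hull (V : lmodType R) (A : set V) : set V :=
  [set v | exists (k : nat) (p : 'I_k -> V) (w : 'I_k -> R),
    [/\ forall j, A (p j),
        forall j, 0 <= w j,
        \sum_j w j = 1 &
        v = \sum_j w j *: p j]].

Definition rank_one_set (N : nat) : set 'M[R]_N :=
  [set Z | exists z : 'cV[R]_N, Z = z *m z^T].

(* The notion is meant for closed convex subcones of the PSD cone; [spec_cone]
   below is such a cone for every family of constraints. *)
Definition rank_one_generated (N : nat) (S : set 'M[R]_N) : Prop :=
  S = convex_hull (S `&` @rank_one_set N).

Definition spec_cone (N : nat) (Ms : set 'M[R]_N) : set 'M[R]_N :=
  [set Z | psd_cone Z /\ forall M, Ms M -> trace_inner M Z <= 0].

Definition homog (n : nat) (x : 'cV[R]_n) : 'cV[R]_(n + 1) :=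
  col_mx x (1%:M : 'M[R]_1).

Definition quad_fun (n : nat) (M : 'M[R]_(n + 1)) (x : 'cV[R]_n) : R :=
  quad_form M (homog x).

Definition e_last (n : nat) : 'cV[R]_(n + 1) := delta_mx (rshift n ord0) 0.

End Defs.

(* Main.v *)
Require Import Defs.
From HB Require Import structures.
From mathcomp Require Import all_boot all_order all_algebra.
From mathcomp Require Import mathcomp_extra boolp classical_sets reals.
From mathcomp Require Import ring lra.

Import Order.TTheory GRing.Theory Num.Theory.

Local Open Scope classical_set_scope.
Local Open Scope ring_scope.

(** Put [A = Mobj - alpha e e^T].  If [Mobj] is at least [alpha] on the feasible
    set, then [<A, z z^T> >= 0] for every [z z^T] in the spectrahedral cone: for
    [z] with nonzero last entry rescale it to [(x, 1)], and for last entry zero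
    use dual feasibility.  Rank-one generation extends this to the whole cone.
    Slater's condition then yields the multipliers through a Farkas lemma for
    linear forms on a convex cone.  The latter needs no separation theorem: the
    constraints are absorbed one at a time, and for a single constraint
    [g <= 0] the multiplier is the supremum of [- f z / g z] over [g z > 0],
    bounded because suitable positive combinations of two points lie on [g = 0]. *)

Section ConicFarkas.
Context {R : realType} {V : lmodType R}.
Implicit Types (C : set V) (f g : V -> R).

Definition convex_cone C : Prop :=
  forall (a b : R) u v, 0 <= a -> 0 <= b -> C u -> C v -> C (a *: u + b *: v).

Lemma scalar_comb f : scalar f ->
  forall a b u v, f (a *: u + b *: v) = a * f u + b * f v.
Proof.
move=> lf a b u v; rewrite lf; congr (_ + _).
have f0 : f 0 = 0.
  have := lf 1 0 0; rewrite scale1r mul1r addr0 => /eqP.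
  by rewrite -subr_eq subrr => /eqP.
by have := lf b v 0; rewrite addr0 f0 addr0.
Qed.

Lemma conic_farkas1 C f g : convex_cone C -> scalar f -> scalar g ->
    (exists2 z, C z & g z < 0) ->
    (forall z, C z -> g z <= 0 -> 0 <= f z) ->
  exists2 c : R, 0 <= c & forall z, C z -> 0 <= f z + c * g z.
Proof.
move=> coneC lf lg [z0 Cz0 gz0] f_ge0.
have cross u v : C u -> C v -> 0 < g u -> g v < 0 -> - f u / g u <= f v / - g v.
  move=> Cu Cv gu gv; rewrite ler_pdivrMr // mulrAC ler_pdivlMr ?oppr_gt0 //.
  have : 0 <= f (g u *: v + (- g v) *: u).
    by apply: f_ge0; [apply: coneC => //; lra | rewrite scalar_comb //; lra].
  by rewrite scalar_comb //; lra.
(* Including [0] keeps [E] nonempty when [g] is nowhere positive on [C], and makes its supremum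
   nonnegative. *)
pose E := [set c | c = 0 \/ exists2 u, C u /\ 0 < g u & c = - f u / g u].
have E0 : E !=set0 by exists 0; left.
have ubE v : C v -> g v < 0 -> ubound E (f v / - g v).
  move=> Cv gv _ [-> | [u [Cu gu] ->]]; last exact: cross.
  by rewrite divr_ge0 ?oppr_ge0 ?f_ge0 // ltW.
have supE : has_sup E by split=> //; exists (f z0 / - g z0); apply: ubE.
exists (sup E); first by apply: ub_le_sup; [case: supE | left].
(* Where [g z < 0] the ratio at [z] is an upper bound of [E]; where [g z > 0] it is a member of [E];
   where [g z = 0] the hypothesis on [f] applies directly. *)
move=> z Cz; case: (ltrgtP (g z) 0) => gz.
- have : sup E <= f z / - g z by apply: ge_sup => //; apply: ubE.
  by rewrite ler_pdivlMr ?oppr_gt0 //; lra.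
- have : - f z / g z <= sup E.
    by apply: ub_le_sup; [case: supE | right; exists z].
  by rewrite ler_pdivrMr //; lra.
- by rewrite gz mulr0 addr0 f_ge0 // gz.
Qed.

(** Induction on [m]: all constraints but the first cut out a subcone of [C], on which the
    one-constraint case absorbs [g ord0] into [f]. The resulting form then satisfies the induction
    hypothesis over the whole of [C]. The same strictly feasible point serves both steps. *)
Lemma conic_farkas m C f (g : 'I_m -> V -> R) :
    convex_cone C -> scalar f -> (forall i, scalar (g i)) ->
    (exists2 z, C z & forall i, g i z < 0) ->
    (forall z, C z -> (forall i, g i z <= 0) -> 0 <= f z) ->
  exists2 c : 'cV[R]_m, nonneg_orthant c &
    forall z, C z -> 0 <= f z + \sum_i c i 0 * g i z.
Proof.
elim: m f g => [|m IHm] f g coneC lf lg [z0 Cz0 gz0] f_ge0.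
  exists 0 => [[]//|z Cz]; rewrite big_ord0 addr0.
  by apply: f_ge0 => // -[].
pose C' := [set z | C z /\ forall i, g (lift ord0 i) z <= 0].
have [|||||c0 c0_ge0 f'_ge0] := @conic_farkas1 C' f (g ord0) => //.
- move=> a b u v a0 b0 [Cu gu] [Cv gv]; split; first exact: coneC.
  by move=> i; rewrite scalar_comb //; have := gu i; have := gv i; nra.
- by exists z0 => //; split=> // i; apply: ltW.
- move=> z [Cz gz] g0z; apply: f_ge0 => // i.
  by case: (unliftP ord0 i) => [j|] ->.
have [|||||c c_ge0 hc] :=
    IHm (fun z => f z + c0 * g ord0 z) (fun i => g (lift ord0 i)) => //.
- by move=> a u v; rewrite lf lg; ring.
- by exists z0.
- by move=> z Cz gz; apply: f'_ge0.
(* The new multiplier [c0] goes to index [ord0], where [unlift] returns [None]; the others are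
   shifted by one. *)
exists (\col_i oapp (fun j => c j 0) c0 (unlift ord0 i)).
  by move=> i; rewrite mxE; case: unlift => /=.
move=> z Cz; rewrite big_ord_recl mxE unlift_none /= addrA.
under eq_bigr do rewrite mxE liftK /=.
exact: hc.
Qed.

End ConicFarkas.

Section QuadraticForms.
Context {R : realType}.

(** Cyclicity of the trace leaves a one-by-one matrix, and transposing it turns [A^T] back into
    [A]. *)
Lemma trace_inner_rank_one N (A : 'M[R]_N) (z : 'cV[R]_N) :
  trace_inner A (z *m z^T) = quad_form A z.
Proof.
rewrite /trace_inner /quad_form mulmxA mxtrace_mulC -[LHS]mxtrace_tr.
by rewrite !trmx_mul !trmxK /mxtrace big_ord1.
Qed.

Lemma trace_inner_scalar N (A : 'M[R]_N) : scalar (trace_inner A).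
Proof.
by move=> a u v; rewrite /trace_inner mulmxDr -scalemxAr linearP.
Qed.

Lemma quad_formD N (A B : 'M[R]_N) z :
  quad_form (A + B) z = quad_form A z + quad_form B z.
Proof. by rewrite /quad_form mulmxDr mulmxDl mxE. Qed.

Lemma quad_formZ N a (A : 'M[R]_N) z : quad_form (a *: A) z = a * quad_form A z.
Proof. by rewrite /quad_form -scalemxAr -scalemxAl mxE. Qed.

Lemma quad_formN N (A : 'M[R]_N) z : quad_form (- A) z = - quad_form A z.
Proof. by rewrite -scaleN1r quad_formZ mulN1r. Qed.

Lemma quad_form_sum N m (F : 'I_m -> 'M[R]_N) z :
  quad_form (\sum_i F i) z = \sum_i quad_form (F i) z.
Proof. by rewrite /quad_form mulmx_sumr mulmx_suml summxE. Qed.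

Lemma quad_form_scale N (A : 'M[R]_N) a z :
  quad_form A (a *: z) = a ^+ 2 * quad_form A z.
Proof. by rewrite /quad_form !linearZ /= -!scalemxAl !mxE mulrA. Qed.

Lemma quad_form_rank_one N (u z : 'cV[R]_N) :
  quad_form (u *m u^T) z = ((u^T *m z) 0 0) ^+ 2.
Proof.
rewrite /quad_form mulmxA -mulmxA mxE big_ord1 expr2; congr (_ * _).
by rewrite -[z^T *m u]trmxK trmx_mul trmxK mxE.
Qed.

Lemma quad_form_e_last n (z : 'cV[R]_(n + 1)) :
  quad_form (e_last n *m (e_last n)^T) z = (dsubmx z 0 0) ^+ 2.
Proof. by rewrite quad_form_rank_one /e_last trmx_delta -rowE !mxE. Qed.

Lemma symmetricmxP N (A : 'M[R]_N) : reflect (A^T = A) (A \is symmetricmx).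
Proof.
by rewrite is_hermitianmxE expr0 scale1r map_mx_id // eq_sym; apply: eqP.
Qed.

Lemma psd_rank_one N (z : 'cV[R]_N) : psd_cone (z *m z^T).
Proof.
split; first by apply/symmetricmxP; rewrite trmx_mul trmxK.
by move=> y; rewrite quad_form_rank_one sqr_ge0.
Qed.

Lemma psd_convex_cone N : convex_cone (@psd_cone R N).
Proof.
move=> a b A B a0 b0 [sA pA] [sB pB]; split.
  apply/symmetricmxP; rewrite linearD !linearZ /=.
  by move/symmetricmxP: sA => ->; move/symmetricmxP: sB => ->.
by move=> z; rewrite quad_formD !quad_formZ addr_ge0 // mulr_ge0.
Qed.

Lemma homog_rescale n (z : 'cV[R]_(n + 1)) (t := dsubmx z 0 0) :
  t != 0 -> z = t *: homog (t^-1 *: usubmx z).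
Proof.
move=> t0; rewrite /homog scale_col_mx scalerA divff // scale1r.
rewrite -[LHS]vsubmxK; congr col_mx.
by rewrite scale_scalar_mx mulr1 [LHS]mx11_scalar.
Qed.

(** By linearity it is enough to treat the rank-one members of the cone, for which membership and
    conclusion both become inequalities between quadratic forms at one vector. *)
Lemma spec_cone_forms_ge0 N (Ms : set 'M[R]_N) (A : 'M[R]_N) :
    rank_one_generated (spec_cone Ms) ->
    (forall z, (forall B, Ms B -> quad_form B z <= 0) -> 0 <= quad_form A z) ->
  forall Z, spec_cone Ms Z -> 0 <= trace_inner A Z.
Proof.
move=> rog A_ge0 Z; rewrite rog => -[k [p [w [Sp w0 _ ->]]]].
rewrite /trace_inner mulmx_sumr linear_sum sumr_ge0 // => j _.
rewrite /= -scalemxAr linearZ mulr_ge0 //=.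
have [[_ hp] [z pz]] := Sp j.
rewrite -/(trace_inner A (p j)) pz trace_inner_rank_one; apply: A_ge0 => B MB.
by rewrite -trace_inner_rank_one -pz hp.
Qed.

End QuadraticForms.

Theorem corollary2 (R : realType) (n m : nat)
    (M : 'I_m -> 'M[R]_(n + 1)) (Mobj : 'M[R]_(n + 1))
    (M_sym : forall i, M i \is symmetricmx)
    (Mobj_sym : Mobj \is symmetricmx)
    (rog : rank_one_generated (spec_cone (range M)))
    (slater : exists xbar : 'cV[R]_n, forall i, quad_fun (M i) xbar < 0)
    (dual_feasible : exists (gammabar : 'cV[R]_m) (alphabar : R),
        nonneg_orthant gammabar /\
        psd_cone (Mobj + \sum_(i < m) gammabar i 0 *: M i
                  - alphabar *: (e_last n *m (e_last n)^T))) :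
  forall alpha : R,
    (forall x : 'cV[R]_n,
        (forall i, quad_fun (M i) x <= 0) -> alpha <= quad_fun Mobj x)
    <->
    (exists gamma : 'cV[R]_m,
        nonneg_orthant gamma /\
        forall x : 'cV[R]_n,
          alpha <= quad_fun Mobj x + \sum_(i < m) gamma i 0 * quad_fun (M i) x).
Proof.
move=> alpha; split; last first.
  move=> [c [c0 hc]] x qx; apply: le_trans (hc x) _.
  by rewrite gerDl sumr_le0 // => i _; rewrite mulr_ge0_le0.
move=> obj_ge.
pose A := Mobj - alpha *: (e_last n *m (e_last n)^T).
have quadA z : quad_form A z = quad_form Mobj z - alpha * (dsubmx z 0 0) ^+ 2.
  by rewrite quad_formD quad_formN quad_formZ quad_form_e_last.
have quadA_homog x : quad_form A (homog x) = quad_fun Mobj x - alpha.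
  by rewrite quadA /homog col_mxKd mxE eqxx expr1n mulr1.
have A_ge0 z : (forall B, range M B -> quad_form B z <= 0) -> 0 <= quad_form A z.
  move=> Mz; have {}Mz i : quad_form (M i) z <= 0 by apply: Mz; exists i.
  have [t0|t0] := eqVneq (dsubmx z 0 0) 0.
    (* At such [z] the [e_last] terms vanish, so [alpha] and the dual constant drop out; what
       remains of the dual certificate bounds the form of [Mobj] below by minus a nonpositive
       sum. *)
    have [c [a [c0 [_ /(_ z)]]]] := dual_feasible.
    rewrite quadA !quad_formD quad_formN quad_formZ quad_form_e_last t0.
    rewrite quad_form_sum expr0n /= !mulr0 !subr0 => /le_trans; apply.
    rewrite gerDl sumr_le0 // => i _.
    by rewrite quad_formZ mulr_ge0_le0.
  rewrite [z](homog_rescale _) // quad_form_scale mulr_ge0 ?sqr_ge0 //.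
  rewrite quadA_homog subr_ge0; apply: obj_ge => i.
  (* Feasibility of the rescaled point: its constraint values are those at [z] divided by a positive
     square. *)
  rewrite -(pmulr_rle0 _ (_ : 0 < (dsubmx z 0 0) ^+ 2)) ?exprn_even_gt0 //.
  by rewrite -quad_form_scale -homog_rescale.
have [|||||c c0 hc] := @conic_farkas R _ m (@psd_cone R (n + 1))
    (trace_inner A) (fun i => trace_inner (M i)).
- exact: psd_convex_cone.
- exact: trace_inner_scalar.
- by move=> i; apply: trace_inner_scalar.
- have [x qx] := slater; exists (homog x *m (homog x)^T); first exact: psd_rank_one.
  by move=> i; rewrite trace_inner_rank_one; apply: qx.
- move=> Z pZ MZ; apply: (spec_cone_forms_ge0 _ _ _ rog A_ge0).
  by split=> // _ [i _ <-].
exists c; split=> // x.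
(* Evaluating the matrix inequality at the rank-one lift of [x] returns to the original
   functions. *)
have := hc _ (psd_rank_one _ (homog x)).
under eq_bigr do rewrite trace_inner_rank_one.
by rewrite trace_inner_rank_one quadA_homog addrAC subr_ge0.
Qed.
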